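(* Let $W$ be a non-degenerate weighted homogeneous polynomial of weight $(w_1,\dots,w_n;h)$, and let $\Gamma_W$ be its monodromy orbit in $[M_W/G_W]$. Then $$\deg(\Gamma_W)=-\mu_{RS}(\Gamma_W)=-\frac{2\big(\sum_{i=1}^nw_i-h\big)}{h}.$$
   Context: $W(\lambda^{w_1}z_1,\dots,\lambda^{w_n}z_n)=\lambda^hW(z)$ with $\gcd(w_1,\dots,w_n,h)=1$; non-degenerate means isolated singularity at $0$ and no monomial $x_ix_j$ with $i\ne j$. $G_W$ is the finite group of diagonal symmetries of $W$, $M_W=W^{-1}(1)$, $L_W=W^{-1}(0)\cap S^{2n-1}_\delta$, $J=(e^{2\pi iw_k/h})_k\in G_W$. The Reeb flow on $L_W$ is $\mathcal{R}_t(z)=(e^{2\pi iw_kt/h}z_k)_k$, $\mathcal R_1=J$, and $L_W/G_W$ models the contact boundary of $[M_W/G_W]$. For $g\in G_W$, $l>0$, $\Sigma_{g,l}\subset L_W$ is the set of points with $g\mathcal{R}_l(p)=p$, i.e. the space of $g$-twisted Reeb orbits of period $l$; in particular $\Sigma_{J^{-1},1}=L_W$ (principal orbits). Index: the holomorphic volume form $\Omega_{M_W}$ is induced by $\mathrm{Res}_W\,dz_1\wedge\dots\wedge dz_n$ on the fibers of $W$; $\Omega_{M_W}^{\otimes|G_W|}$ descends to $[M_W/G_W]$. $\mu_{RS}(\Sigma_{g,l})$ is the Robbin–Salamon index of the linearized flow of a twisted orbit with respect to $\Omega_{M_W}^{\otimes|G_W|}$, divided by $|G_W|$: concretely, for a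 complex frame $(f_i)$ of $TM_W$ along the orbit $\gamma:[0,l]\to M_W$ with $g\cdot f_i(l)=f_i(0)$, it equals the Robbin–Salamon index of the linearized flow in this frame plus $2$ times the total change of $\frac{1}{2\pi}\arg\Omega_{M_W}(f_1,\dots,f_{n-1})$ over $[0,l]$. A path $e^{2\pi i st}$, $t\in[0,1]$, in $U(1)$ has Robbin–Salamon index $2s$ if $s\in\mathbb{Z}$ and $2\lfloor s\rfloor+1$ otherwise. Degree: after a $G_W$-equivariant Morse perturbation, the generator corresponding to a class of degree $d$ on $\Sigma_{g,l}/G_W$ has degree $d+\star_{g,l}$, where $\star_{g,l}=(n-1)-\mu_{RS}(\Sigma_{g,l})-\frac12(\dim_{\mathbb{R}}\Sigma_{g,l}+1)$. $\Gamma_W$ is the cochain corresponding to the fundamental class of $\Sigma_{J^{-1},1}/G_W\cong L_W/G_W$ (the generator $1$ of $H^0$), and $\mu_{RS}(\Gamma_W)=\mu_{RS}(\Sigma_{J^{-1},1})$. *)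

(* Defs.v *)
From mathcomp Require Import all_boot all_order all_algebra.
From mathcomp Require Import complex.
From mathcomp Require Import all_classical all_reals all_analysis.
(* mpoly is not imported: its notations clash with those of mathcomp-analysis *)
From mathcomp Require mpoly.

Set Implicit Arguments.
Unset Strict Implicit.
Unset Printing Implicit Defensive.

Import Order.TTheory GRing.Theory Num.Theory.
Import numFieldNormedType.Exports.

Local Open Scope classical_set_scope.
Local Open Scope ring_scope.
Local Open Scope complex_scope.
Local Open Scope sesquilinear_scope.

Section RobbinSalamon.
Variable R : realType.
Local Notation C := R[i].

Definition e2pi (x : R) : C := cos (2 * pi * x) +i* sin (2 * pi * x).

(* The Robbin-Salamon index of the path t |-> e2pi (s * t), 0 <= t <= 1, in
   U(1). *)
Definition RS_U1 (s : R) : R :=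
  if s \is a Num.int then 2 * s else 2 * (Num.floor s)%:~R + 1.

Lemma e2piD (x y : R) : e2pi (x + y) = e2pi x * e2pi y.
Proof.
rewrite /e2pi mulrDr cosD sinD; apply/eqP; rewrite eq_complex /=.
by rewrite eqxx /= [X in _ == X]addrC.
Qed.

Lemma e2pi0 : e2pi 0 = 1.
Proof. by rewrite /e2pi mulr0 cos0 sin0. Qed.

Lemma e2pi1 : e2pi 1 = 1.
Proof. by rewrite /e2pi mulr1 mulr_natl cos2pi sin2pi. Qed.

Lemma e2pi_neq0 (x : R) : e2pi x != 0.
Proof.
apply/eqP => ex0; have := e2piD x (- x).
by rewrite subrr e2pi0 ex0 mul0r => /eqP; rewrite oner_eq0.
Qed.

Lemma e2piMn (x : R) k : e2pi x ^+ k = e2pi (k%:R * x).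
Proof.
elim: k => [|k IHk]; first by rewrite mul0r e2pi0.
by rewrite exprS IHk -natr1 mulrDl mul1r addrC e2piD.
Qed.

(* Homotopy, with fixed end points, of paths [0, 1] -> U(m). R[i]^o carries the
   topology of the modulus. *)
Definition homotopic_rel_ends m (A B : R -> 'M[C]_m) : Prop :=
  exists H : R * R -> 'M[C]_m,
    [/\ {within `[0, 1] `*` `[0, 1],
           continuous (H : R * R -> 'M[C^o]_m)},
        forall s t, s \in `[0, 1] -> t \in `[0, 1] -> H (s, t) \is unitarymx,
        forall t, t \in `[0, 1] -> H (0, t) = A t /\ H (1, t) = B t
      & forall s, s \in `[0, 1] -> H (s, 0) = A 0 /\ H (s, 1) = A 1].

(* The Robbin-Salamon index of a path A : [0, 1] -> U(m) issued from 1, where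
   U(m) = Sp(2m) :&: O(2m). The index is invariant under homotopies with fixed
   end points and under conjugation, and additive under direct sums. Every
   path in U(m) issued from 1 is homotopic, with fixed end points, to a
   conjugate of a direct sum of paths t |-> e2pi (s_k * t) in U(1), so these
   rules determine it. *)
Definition RS_index m (A : R -> 'M[C]_m) : set R :=
  [set r | exists (P : 'M[C]_m) (s : 'I_m -> R),
     [/\ P \is unitarymx,
         homotopic_rel_ends A
           (fun t => P *m diag_mx (\row_k e2pi (s k * t)) *m P^t*)
       & r = \sum_k RS_U1 (s k)]].

(* d is the variation over [0, l] of a continuous branch of arg phi / (2 pi). *)
Definition arg_variation (phi : R -> C) (l : R) : set R :=
  [set d | exists theta : R -> R,
     [/\ {within `[0, l], continuous theta},
         forall t, t \in `[0, l] ->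
           phi t != 0 /\ phi t = `|phi t| * e2pi (theta t)
       & d = theta l - theta 0]].

End RobbinSalamon.

Section WeightedHomogeneous.
Variables (R : realType) (n : nat).
Local Notation C := R[i].
Implicit Types (W : mpoly.mpoly n C) (z p v : 'cV[C]_n) (g : 'rV[C]_n).

Definition peval W z : C := mpoly.meval (fun i => z i 0) W.

Definition pderiv W (i : 'I_n) z : C := peval (mpoly.mderiv i W) z.

Definition dpeval W p v : C := \sum_i pderiv W i p * v i 0.

Record weighted_homogeneous W (w : 'I_n -> nat) (h : nat) : Prop := {
  weight_gt0 : forall i, (0 < w i)%N;
  degree_gt0 : (0 < h)%N;
  gcd_weights : gcdn (\big[gcdn/0%N]_i w i) h = 1%N;
  homogeneity : forall (lambda : C) z,
    peval W (diag_mx (\row_i lambda ^+ w i) *m z) = lambda ^+ h * peval W z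
}.

Definition singular_point W z : Prop :=
  peval W z = 0 /\ forall i, pderiv W i z = 0.

Definition isolated_singularity0 W : Prop :=
  singular_point W 0 /\
  \forall z \near (0 : 'cV[C^o]_n)^', ~ singular_point W z.

Definition nondegenerate_polynomial W : Prop :=
  isolated_singularity0 W /\
  forall i j : 'I_n, i != j ->
    mpoly.mcoeff (mpoly.mnm_add (mpoly.mnm1 i) (mpoly.mnm1 j)) W = 0.

(* A diagonal transformation is identified with the row of its entries; it acts
   by diag_mx. *)
Definition diag_symmetry W : set 'rV[C]_n :=
  [set g : 'rV[C]_n | (forall i, g 0 i != 0) /\
           forall z, peval W (diag_mx g *m z) = peval W z].

Definition link W (delta : R) : set 'cV[C]_n :=
  [set z : 'cV[C]_n | peval W z = 0 /\ \sum_i `|z i 0| ^+ 2 = (delta ^+ 2)%:C].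

Definition monodromy (w : 'I_n -> nat) (h : nat) : 'rV[C]_n :=
  \row_i e2pi ((w i)%:R / h%:R).

Definition reeb_flow (w : 'I_n -> nat) (h : nat) (t : R) : 'rV[C]_n :=
  \row_i e2pi ((w i)%:R * t / h%:R).

Definition Sigma W w h (delta : R) g (l : R) : set 'cV[C]_n :=
  [set p : 'cV[C]_n | link W delta p /\
           diag_mx g *m (diag_mx (reeb_flow w h l) *m p) = p].

(* The tangent space at p of Sigma W w h delta g l, given by the linearization
   of the equations W = 0, |z|^2 = delta^2 and g (R_l z) = z. *)
Definition tangent_Sigma W w h g (l : R) p : set 'cV[C]_n :=
  [set v : 'cV[C]_n | [/\ dpeval W p v = 0,
               complex.Re ((p^t* *m v) 0 0) = 0
             & diag_mx g *m (diag_mx (reeb_flow w h l) *m v) = v]].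

Definition real_basis (V : set 'cV[C]_n) d (b : 'I_d -> 'cV[C]_n) : Prop :=
  forall v, V v <-> exists! c : 'rV[R]_d, v = \sum_k (c 0 k)%:C *: b k.

Definition dim_Sigma W w h delta g l : nat :=
  xget 0%N [set d | exists p (b : 'I_d -> 'cV[C]_n),
    Sigma W w h delta g l p /\ real_basis (tangent_Sigma W w h g l p) b].

(* A generator of the complex of [M_W / G_W], before the Morse perturbation: a
   cohomology class of degree gen_class on the quotient by G_W of the space of
   gen_twist-twisted Reeb orbits of period gen_period. *)
Record generator W := Generator {
  gen_twist : 'rV[C]_n;
  gen_twist_sym : diag_symmetry W gen_twist;
  gen_period : R;
  gen_period_gt0 : 0 < gen_period;
  gen_class : nat
}.

Lemma monodromy_inv_sym W w h : weighted_homogeneous W w h ->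
  diag_symmetry W (map_mx GRing.inv (monodromy w h)).
Proof.
case=> w0 h0 _ hom.
have hn0 : h%:R != 0 :> R by rewrite pnatr_eq0 -lt0n.
have E k : (e2pi (h%:R^-1 : R))^-1 ^+ k = (e2pi (k%:R / h%:R))^-1.
  by rewrite exprVn e2piMn.
split=> [i|z]; first by rewrite !mxE invr_eq0 e2pi_neq0.
have -> : map_mx GRing.inv (monodromy w h) =
          \row_i (e2pi (h%:R^-1 : R))^-1 ^+ w i.
  by apply/rowP=> i; rewrite !mxE E.
by rewrite hom E divff // e2pi1 invr1 mul1r.
Qed.

(* Gamma_W: the class 1 in H^0 of the quotient by G_W of the space of principal
   orbits. *)
Definition monodromy_orbit W w h (hW : weighted_homogeneous W w h) :
    generator W :=
  Generator (monodromy_inv_sym hW) ltr01 0.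

End WeightedHomogeneous.

(* Polynomials in n = m.+1 variables, whose fibers have complex dimension m. *)
Section Index.
Variables (R : realType) (m : nat).
Local Notation C := R[i].
Implicit Types (W : mpoly.mpoly m.+1 C) (p : 'cV[C]_m.+1) (g : 'rV[C]_m.+1).

Definition conormal W p : 'cV[C]_m.+1 :=
  \col_i ((pderiv W i p)^* / \sum_j `|pderiv W j p| ^+ 2).

(* The residue form on the fiber of W through p, characterized by
   dz_1 /\ .. /\ dz_n = dW /\ Omega, evaluated on the columns of V. When these
   are tangent to the fiber, conormal W p may be replaced by any vector nu with
   dW(nu) = 1. *)
Definition residue_form W p (V : 'M[C]_(m.+1, m)) : C :=
  \det (row_mx (conormal W p) V : 'M[C]_m.+1).

(* The columns of F t form a complex frame of the tangent space at R_t p of the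
   fiber of W, for t in [0, l], compatible with the action of g. It is unitary
   so that the linearized flow, which is unitary, becomes a path in U(m). *)
Definition twisted_frame W w h g (l : R) p (F : R -> 'M[C]_(m.+1, m)) : Prop :=
  [/\ {within `[0, l], continuous (F : R -> 'M[C^o]_(m.+1, m))},
      forall t, t \in `[0, l] ->
        (forall k, dpeval W (diag_mx (reeb_flow w h t) *m p)
                                  (col k (F t)) = 0)
        /\ (F t)^t* *m F t = 1%:M
    & diag_mx g *m F l = F 0].

(* The matrix of the linearized flow in the frame F, that is, the A t such that
   diag_mx (reeb_flow w h t) *m F 0 = F t *m A t. *)
Definition linearized_flow (w : 'I_m.+1 -> nat) (h : nat)
    (F : R -> 'M[C]_(m.+1, m)) (t : R) : 'M[C]_m :=
  (F t)^t* *m (diag_mx (reeb_flow w h t) *m F 0).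

Definition orbit_RS_index W w h g (l : R) p : set R :=
  [set mu | exists F r d,
    [/\ twisted_frame W w h g l p F,
        RS_index (fun t => linearized_flow w h F (l * t)) r,
        arg_variation (fun t =>
          residue_form W (diag_mx (reeb_flow w h t) *m p) (F t)) l d
      & mu = r + 2 * d]].

(* The index does not depend on the point of Sigma W w h delta g l. *)
Definition mu_RS W w h (delta : R) (x : generator W) : R :=
  xget 0 [set mu | exists2 p,
    Sigma W w h delta (gen_twist x) (gen_period x) p
    & orbit_RS_index W w h (gen_twist x) (gen_period x) p mu].

Definition star W w h (delta : R) (x : generator W) : R :=
  m%:R - mu_RS w h delta x
  - ((dim_Sigma W w h delta (gen_twist x) (gen_period x))%:R + 1) / 2.

Definition gen_degree W w h (delta : R) (x : generator W) : R :=
  (gen_class x)%:R + star w h delta x.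

End Index.

(* Main.v *)
(* The Reeb flow R_t is linear and unitary and pulls the residue form Omega back
   to e2pi (lambda * t) Omega, with lambda = sum_i w_i / h - 1. In the
   flow-invariant frame the linearized flow is constant and the whole index
   comes from this phase, which gives 2 * lambda. In an arbitrary unitary frame
   F, comparing Omega on F t and on R_t (F 0) gives the phase of the determinant
   of the linearized flow A; since R_1 composed with the twist is the identity,
   A is a loop, its index is twice the winding number of det A, and adding the
   variation of arg Omega (F t) yields 2 * lambda again. For the degree it
   remains to see that the space of principal orbits has real dimension 2 m - 1:
   dW does not vanish on the link because the singularity is isolated, and the
   Euler field, which dW annihilates, is transverse to the sphere. *)

Require Import Defs.
From mathcomp Require Import all_boot all_order all_algebra.
From mathcomp Require Import complex.
From mathcomp Require Import all_classical all_reals all_analysis.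
From mathcomp Require Import ring lra.
From mathcomp Require mpoly.

Set Implicit Arguments.
Unset Strict Implicit.
Unset Printing Implicit Defensive.

Import Order.TTheory GRing.Theory Num.Theory.
Import numFieldNormedType.Exports.

Local Open Scope classical_set_scope.
Local Open Scope ring_scope.
Local Open Scope complex_scope.
Local Open Scope sesquilinear_scope.

(** * Polynomials along curves and weighted homogeneity *)

Section Curves.
Variables (n : nat) (A : comNzRingType).
Implicit Types (W : mpoly.mpoly n A) (u : 'I_n -> {poly A}).

(** [mpoly.mmap polyC u W] is W composed with the polynomial curve [u], so that derivatives of W
    along curves become formal derivatives. *)
Lemma mmap_horner u W x :
  (mpoly.mmap polyC u W).[x] = mpoly.meval (fun i => (u i).[x]) W.
Proof.
rewrite /mpoly.mmap mpoly.mevalE horner_sum; apply: eq_bigr => k _.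
rewrite hornerM hornerC; congr (_ * _).
by rewrite /mpoly.mmap1 horner_prod; apply: eq_bigr => i _; rewrite horner_exp.
Qed.

Lemma deriv_prod (I : finType) (f : I -> {poly A}) :
  (\prod_i f i)^`() = \sum_i (f i)^`() * \prod_(j | j != i) f j.
Proof.
(* As [r] has no repetitions, the condition [j != i] removes exactly one factor. *)
suff H (r : seq I) : uniq r ->
    (\prod_(i <- r) f i)^`() =
    \sum_(i <- r) (f i)^`() * \prod_(j <- r | j != i) f j.
  by have := H _ (index_enum_uniq I).
elim: r => [|a r IHr] /=; first by rewrite !big_nil derivC.
move=> /andP[ar ur]; rewrite !big_cons derivM IHr // eqxx /=; congr (_ + _).
  congr (_ * _); rewrite big_seq [in RHS]big_seq_cond; apply: eq_bigl => j.
  by case: eqVneq => [->|]; rewrite ?(negPf ar) ?andbT.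
rewrite mulr_sumr big_seq [in RHS]big_seq; apply: eq_bigr => i ir.
rewrite big_cons; case: eqVneq => [ai|_]; last by rewrite mulrCA.
by rewrite -ai (negPf ar) in ir.
Qed.

Lemma deriv_mmap u W :
  (mpoly.mmap polyC u W)^`() =
  \sum_i (u i)^`() * mpoly.mmap polyC u (mpoly.mderiv i W).
Proof.
elim/mpoly.mpolyind: W => [|c k W _ _ IHW].
  rewrite mpoly.mmap0 derivC big1 // => i _.
  by rewrite mpoly.mderiv0 mpoly.mmap0 mulr0.
rewrite mpoly.mmapD mpoly.mmapZ mpoly.mmapX derivD IHW.
rewrite derivM derivC mul0r add0r.
rewrite /mpoly.mmap1 deriv_prod mulr_sumr -big_split; apply: eq_bigr => i _ /=.
rewrite mpoly.mderivD mpoly.mderivZ mpoly.mderivX mpoly.mmapD !mpoly.mmapZ.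
rewrite mpoly.mmapX mulrDr; congr (_ + _).
rewrite deriv_exp /= polyC_natr mulr_natl mulrnAl !mulrnAr -mulrA mulrCA.
congr (_ *+ _); congr (_ * (_ * _)).
rewrite /mpoly.mmap1 [RHS](bigD1 i) //= mpoly.mnmBE mpoly.mnm1E eqxx subn1.
congr (_ * _); apply: eq_bigr => j ji.
by rewrite mpoly.mnmBE mpoly.mnm1E eq_sym (negPf ji) subn0.
Qed.

End Curves.

(** Homogeneity is an identity between values; agreement at all natural numbers turns it into an
    identity of polynomials, which can be differentiated. *)
Lemma poly_nat_roots (F : numDomainType) (q : {poly F}) :
  (forall k : nat, q.[k%:R] = 0) -> q = 0.
Proof.
move=> q0; apply/eqP/negPn/negP => qn0.
have := @max_poly_roots _ q [seq k%:R | k <- iota 0 (size q)] qn0.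
rewrite size_map size_iota ltnn => H; apply: notF; apply: H.
  by apply/allP => x /mapP[k _ ->]; apply/rootP; exact: q0.
rewrite map_inj_uniq ?iota_uniq // => a b /eqP.
by rewrite eqr_nat => /eqP.
Qed.

(** * Euler's identity and homogeneity of the differential *)

Section Homogeneous.
Variables (R : realType) (n : nat) (W : mpoly.mpoly n R[i]).
Variables (w : 'I_n -> nat) (h : nat).
Hypothesis W_homogeneous : weighted_homogeneous W w h.
Local Notation C := R[i].
Implicit Types (p v : 'cV[C]_n) (x : C).

Definition weight_scaling x : 'rV[C]_n := \row_i x ^+ w i.

Lemma mul_diag_mxE (d : 'rV[C]_n) p i : (diag_mx d *m p) i 0 = d 0 i * p i 0.
Proof. by rewrite mul_diag_mx mxE. Qed.

Lemma mmap_curve (u : 'I_n -> {poly C}) x :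
  (mpoly.mmap polyC u W).[x] = peval W (\col_i (u i).[x]).
Proof.
rewrite mmap_horner /peval; apply: mpoly.meval_eq => i.
by rewrite mxE.
Qed.

Lemma deriv_mmap_curve (u : 'I_n -> {poly C}) x :
  ((mpoly.mmap polyC u W)^`()).[x] =
  dpeval W (\col_i (u i).[x]) (\col_i ((u i)^`()).[x]).
Proof.
rewrite deriv_mmap horner_sum; apply: eq_bigr => i _.
rewrite hornerM mulrC mxE /pderiv /peval mmap_horner; congr (_ * _).
by apply: mpoly.meval_eq => j; rewrite mxE.
Qed.

(** Differentiate W(x^w p) = x^h W(p) in x at x = 1. *)
Lemma euler_identity p :
  dpeval W p (\col_i ((w i)%:R * p i 0)) = h%:R * peval W p.
Proof.
pose u i := p i 0 *: 'X^(w i).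
have E : mpoly.mmap polyC u W = peval W p *: 'X^h.
  apply/eqP; rewrite -subr_eq0; apply/eqP/poly_nat_roots => k.
  rewrite hornerD hornerN mmap_curve hornerZ hornerXn.
  suff -> : \col_i (u i).[k%:R] = diag_mx (weight_scaling k%:R) *m p.
    by rewrite (homogeneity W_homogeneous) mulrC subrr.
  apply/colP => i.
  by rewrite mul_diag_mxE !mxE hornerZ hornerXn mulrC.
have := deriv_mmap_curve u 1.
rewrite E derivZ derivXn hornerZ hornerMn hornerXn expr1n mulrC => ->.
congr (dpeval W _ _); apply/colP => i; rewrite !mxE /u.
  by rewrite hornerZ hornerXn expr1n mulr1.
by rewrite derivZ derivXn hornerZ hornerMn hornerXn expr1n mulrC.
Qed.

(** Apply homogeneity along the line p + X v and differentiate at X = 0. *)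
Lemma dpeval_homogeneous x p v :
  dpeval W (diag_mx (weight_scaling x) *m p)
    (diag_mx (weight_scaling x) *m v) = x ^+ h * dpeval W p v.
Proof.
pose u i : {poly C} := (p i 0)%:P + v i 0 *: 'X.
pose ux i : {poly C} := x ^+ w i *: u i.
have E : mpoly.mmap polyC ux W = x ^+ h *: mpoly.mmap polyC u W.
  apply/eqP; rewrite -subr_eq0; apply/eqP/poly_nat_roots => k.
  rewrite hornerD hornerN hornerZ !mmap_curve.
  suff -> : \col_i (ux i).[k%:R] =
      diag_mx (weight_scaling x) *m (\col_i (u i).[k%:R]).
    by rewrite (homogeneity W_homogeneous) subrr.
  by apply/colP => i; rewrite mul_diag_mxE !mxE hornerZ.
have := deriv_mmap_curve ux 0.
rewrite E derivZ hornerZ deriv_mmap_curve => H.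
transitivity (x ^+ h * dpeval W (\col_i (u i).[0]) (\col_i ((u i)^`()).[0])).
  rewrite H; congr (dpeval W _ _); apply/colP => i;
    rewrite mul_diag_mxE !mxE.
    by rewrite !hornerE.
  by rewrite derivZ derivD derivC derivZ derivX add0r !hornerZ hornerC mulr1.
congr (_ * dpeval W _ _); apply/colP => i; rewrite !mxE.
  by rewrite !hornerE.
by rewrite derivD derivC derivZ derivX add0r hornerZ hornerC mulr1.
Qed.

Lemma dpevalZ p x v : dpeval W p (x *: v) = x * dpeval W p v.
Proof.
by rewrite /dpeval mulr_sumr; apply: eq_bigr => i _; rewrite mxE mulrCA.
Qed.

Lemma dpeval_delta p i : dpeval W p (delta_mx i 0) = pderiv W i p.
Proof.
rewrite /dpeval (bigD1 i) //= big1 => [|j ji].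
  by rewrite !mxE !eqxx mulr1 addr0.
rewrite !mxE.
by rewrite (negPf ji) mulr0.
Qed.

(** The previous homogeneity for a basis vector; the factor [x ^+ w i] stays on the left so that x =
    0 is allowed. *)
Lemma pderiv_homogeneous x p i :
  pderiv W i (diag_mx (weight_scaling x) *m p) * x ^+ w i =
  x ^+ h * pderiv W i p.
Proof.
rewrite -!dpeval_delta -dpeval_homogeneous mulrC -dpevalZ.
congr (dpeval W _ _); apply/colP => j.
rewrite mul_diag_mxE !mxE eqxx andbT.
by case: eqVneq => [->|]; rewrite ?mulr0.
Qed.

End Homogeneous.

(** * Limits in the complex plane and winding numbers *)

Section UnitCircle.
Variable R : realType.
Local Notation C := R[i].
Implicit Types (x y : R) (z : C).

Lemma twopi_gt0 : 0 < 2 * pi :> R.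
Proof. by rewrite mulr_gt0 // pi_gt0. Qed.

Lemma e2piN x : e2pi (- x) = (e2pi x)^-1.
Proof.
apply: (mulfI (e2pi_neq0 x)).
by rewrite -e2piD subrr e2pi0 mulfV // e2pi_neq0.
Qed.

Lemma e2pi_int (k : int) : e2pi (k%:~R : R) = 1.
Proof.
case: k => k; first by rewrite -[k%:~R]mulr1 -e2piMn e2pi1 expr1n.
by rewrite NegzE mulrNz e2piN -[_%:~R]mulr1 -e2piMn e2pi1 expr1n invr1.
Qed.

(** Reduce x to its fractional part y. Then cos (2 pi y) = 1 forces sin (pi y) = 0 by the double
    angle formula, and sin is positive on the open interval from 0 to pi. *)
Lemma e2pi_eq1 x : (e2pi x == 1) = (x \is a Num.int).
Proof.
apply/eqP/idP => [x1|/intrP[k ->]]; last exact: e2pi_int.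
set y := x - (Num.floor x)%:~R.
have y1 : e2pi y = 1 by rewrite e2piD x1 e2piN e2pi_int invr1 mulr1.
have y0 : 0 <= y by rewrite subr_ge0 floor_le_tmp.
have y1' : y < 1 by rewrite ltrBlDr addrC -intrD1 floorD1_gt.
have : cos (2 * pi * y) = 1 by case: y1.
have -> : 2 * pi * y = (pi * y) *+ 2 by rewrite -mulrA mulr_natl.
rewrite cos_mulr2n => cy.
have : sin (pi * y) = 0.
  have := cos2Dsin2 (pi * y) => cs.
  apply/eqP; rewrite -sqrf_eq0; apply/eqP; lra.
have [y_gt0 sy|] := ltP 0 y.
  have := @sin_gt0_pi R (pi * y).
  rewrite sy ltxx mulr_gt0 ?pi_gt0 //= gtr_pMr ?pi_gt0 // y1'.
  by move=> /(_ isT).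
move=> y_le0 _; have : y = 0 by apply: le_anti; rewrite y_le0 y0.
by move=> /eqP; rewrite subr_eq0 => /eqP ->; exact: rpred_int_num.
Qed.

Lemma e2pi_norm x : `|e2pi x| = 1.
Proof. by rewrite normc_def /= cos2Dsin2 sqrtr1. Qed.

Lemma e2pi_conj x : ((e2pi x)^*)%R = (e2pi x)^-1.
Proof. by rewrite -e2piN /e2pi mulrN cosN sinN. Qed.

Lemma e2pi_inj_mod x y : e2pi x = e2pi y -> x - y \is a Num.int.
Proof.
by move=> xy; rewrite -e2pi_eq1 e2piD e2piN xy mulfV // e2pi_neq0.
Qed.

Lemma polar_form z : exists x, z = `|z| * e2pi x.
Proof.
have [->|z0] := eqVneq z 0; first by exists 0; rewrite normr0 mul0r.
suff [x ux] : exists x, z / `|z| = e2pi x.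
  by exists x; rewrite -ux mulrC divfK // normr_eq0.
have : `|z / `|z| | = 1 by rewrite normf_div normr_id divff // normr_eq0.
case: (z / `|z|) => a b; rewrite normc_def /= => -[ab'].
have ab : a ^+ 2 + b ^+ 2 = 1.
  have ab0 : 0 <= a ^+ 2 + b ^+ 2 by rewrite addr_ge0 ?sqr_ge0.
  by rewrite -[LHS](sqr_sqrtr ab0) ab' expr1n.
have a1 : -1 <= a <= 1.
  rewrite -ler_norml -(@expr_le1 _ 2) // real_normK ?num_real //.
  by rewrite -[leRHS]ab lerDl sqr_ge0.
have ba : 1 - a ^+ 2 = b ^+ 2 by rewrite -ab addrAC subrr add0r.
have [b0|b0] := leP 0 b.
  exists (acos a / (2 * pi)).
  rewrite /e2pi mulrC divfK ?gt_eqF ?twopi_gt0 // acosK // sin_acos //.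
  by rewrite ba sqrtr_sqr ger0_norm.
exists (- (acos a / (2 * pi))).
rewrite /e2pi mulrN mulrC divfK ?gt_eqF ?twopi_gt0 // cosN sinN acosK //.
by rewrite sin_acos // ba sqrtr_sqr ltr0_norm // opprK.
Qed.

End UnitCircle.

(** * Limits of complex-valued and matrix-valued functions *)

Section ComplexLimits.
Variables (R : realType) (T : Type) (F : set_system T).
Hypothesis FF : Filter F.
Local Notation C := R[i].

(** Radii of balls in [C^o] are positive elements of [C]; they are in fact positive reals, which
    lets epsilon arguments pass between [R] and [C]. *)
Lemma complex_gt0E (e : C) : 0 < e -> e = (complex.Re e)%:C /\ 0 < complex.Re e.
Proof. by case: e => a b; rewrite ltcE /= => /andP[/eqP -> ->]. Qed.

Lemma cvg_Re (f : T -> C^o) (l : C^o) :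
  f @ F --> l -> (fun t => complex.Re (f t)) @ F --> complex.Re l.
Proof.
move=> /cvgrPdist_lt fl; apply/cvgrPdist_lt => e e0.
have := fl e%:C; rewrite ltcR => /(_ e0); apply: filterS => t /=.
rewrite -ltcR; apply: le_lt_trans; rewrite -raddfB; exact: normc_ge_Re.
Qed.

Lemma cvg_Im (f : T -> C^o) (l : C^o) :
  f @ F --> l -> (fun t => complex.Im (f t)) @ F --> complex.Im l.
Proof.
have E (z : C) : complex.Im z = - complex.Re (z * 'i%C) by rewrite ReiNIm opprK.
move=> fl; rewrite E; under eq_cvg do rewrite E.
apply: cvgN; apply: (@cvg_Re (fun t => f t * 'i%C)).
by apply: (@cvgM C); last exact: cvg_cst.
Qed.

Lemma cvg_real_complex (f : T -> R) (l : R) :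
  f @ F --> l -> (fun t => (f t)%:C : C^o) @ F --> (l%:C : C^o).
Proof.
move=> /cvgrPdist_lt fl; apply/cvgrPdist_lt => e /complex_gt0E[-> e0].
apply: filterS (fl _ e0) => t.
by rewrite -rmorphB /= normc_def /= expr0n addr0 sqrtr_sqr ltcR.
Qed.

Lemma cvg_complex (f g : T -> R) (a b : R) :
  f @ F --> a -> g @ F --> b ->
  (fun t => f t +i* g t : C^o) @ F --> (a +i* b : C^o).
Proof.
move=> fa gb.
have E (x y : R) : x +i* y = x%:C + 'i%C * y%:C.
  by rewrite [LHS]complexE.
rewrite E; under eq_cvg do rewrite E.
apply: (@cvgD _ C^o); first exact: cvg_real_complex.
by apply: (@cvgM C); [exact: cvg_cst|exact: cvg_real_complex].
Qed.

Lemma cvg_conjc (f : T -> C^o) (l : C^o) :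
  f @ F --> l -> (fun t => ((f t)^*)%C : C^o) @ F --> ((l^*)%C : C^o).
Proof.
have E (z : C) : (z^*)%C = complex.Re z -i* complex.Im z by case: z.
move=> fl; rewrite E; under eq_cvg do rewrite E.
by apply: cvg_complex; [exact: cvg_Re|apply: cvgN; exact: cvg_Im].
Qed.

Lemma cvg_e2pi (f : T -> R) (l : R) :
  f @ F --> l -> (fun t => e2pi (f t) : C^o) @ F --> (e2pi l : C^o).
Proof.
move=> fl; have fl' : (fun t => 2 * pi * f t) @ F --> 2 * pi * l.
  by apply: cvgM => //; exact: cvg_cst.
apply: cvg_complex.
  exact: (cvg_comp _ _ fl' (@continuous_cos R _)).
exact: (cvg_comp _ _ fl' (@continuous_sin R _)).
Qed.

Lemma cvg_mx m n (f : T -> 'M[C^o]_(m, n)) (l : 'M[C^o]_(m, n)) :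
  (forall i j, (fun t => f t i j : C^o) @ F --> (l i j : C^o)) -> f @ F --> l.
Proof.
move=> fl; apply/cvg_ballP => e e0.
have H : \forall t \near F, forall i j, ball (l i j : C^o) e (f t i j).
  have : \forall t \near F, forall ij : 'I_m * 'I_n,
      ball (l ij.1 ij.2 : C^o) e (f t ij.1 ij.2).
    by apply: filter_forall => -[i j]; have /cvg_ballP := fl i j; apply.
  by apply: filterS => t ft i j; exact: (ft (i, j)).
by apply: filterS H => t ft; split.
Qed.

Lemma cvg_coord m n (f : T -> 'M[C^o]_(m, n)) (l : 'M[C^o]_(m, n)) i j :
  f @ F --> l -> (fun t => f t i j : C^o) @ F --> (l i j : C^o).
Proof.
by move=> fl; exact: (cvg_comp _ _ fl (@coord_continuous C m n i j l)).
Qed.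

Lemma cvg_det m (f : T -> 'M[C^o]_m) (l : 'M[C^o]_m) :
  f @ F --> l -> (fun t => \det (f t) : C^o) @ F --> (\det l : C^o).
Proof.
move=> fl; apply: cvg_big => [|s _]; first exact: (@add_continuous C^o).
apply: (@cvgM C); first exact: cvg_cst.
apply: cvg_big => [|i _]; first exact: (@mul_continuous C).
exact: cvg_coord.
Qed.

End ComplexLimits.

(** * Variation of the argument: uniqueness and homotopy invariance *)

Section Winding.
Variable R : realType.
Local Notation C := R[i].
Local Notation I := (`[0, 1]%classic : set R).
Implicit Types (f g phi : R -> C) (d : R).

Lemma unit_itv_ends : I 0 /\ I 1.
Proof. by rewrite /= !in_itv /= !lexx ler01. Qed.

Lemma within_continuousP (T U : topologicalType) (D : set T) (f : T -> U) :
  {within D, continuous f} <->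
  forall x, D x -> f @ within D (nbhs x) --> f x.
Proof. exact: subspace_continuousP. Qed.

(** Were the end values different, the intermediate value theorem would make the smaller one plus
    1/2 an integer. *)
Lemma continuous_int_cst (l : R) (k : R -> R) : 0 <= l ->
  {within `[0, l], continuous k} ->
  (forall t, t \in `[0, l] -> k t \is a Num.int) -> k 0 = k l.
Proof.
move=> l0 kc kint.
have k0 : k 0 \is a Num.int by apply: kint; rewrite in_itv /= lexx.
have kl : k l \is a Num.int by apply: kint; rewrite in_itv /= lexx l0.
have gap (a b : R) : a \is a Num.int -> b \is a Num.int -> a < b -> a + 1 <= b.
  move=> /intrP[x ->] /intrP[y ->]; rewrite ltr_int -[1]/(1%:~R) -intrD ler_int.
  by rewrite lezD1.
have half_int (a : R) : a \is a Num.int -> a + 1 / 2 \is a Num.int -> False.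
  by move=> aZ ahZ; have := gap _ _ aZ ahZ; lra.
have ivt v : Num.min (k 0) (k l) <= v <= Num.max (k 0) (k l) ->
    v \is a Num.int.
  by move=> /(IVT l0 kc)[c cl <-]; exact: kint.
apply/eqP; case: ltgtP => // [lt|lt].
  have := gap _ _ k0 kl lt; move=> le; case: (half_int _ k0); apply: ivt.
  by rewrite min_l ?max_r ?(ltW lt) //; lra.
have := gap _ _ kl k0 lt; move=> le; case: (half_int _ kl); apply: ivt.
by rewrite min_r ?max_l ?(ltW lt) //; lra.
Qed.

(** Two continuous branches differ by a continuous integer-valued function. *)
Lemma arg_variation_uniq phi (l : R) d d' : 0 <= l ->
  arg_variation phi l d -> arg_variation phi l d' -> d = d'.
Proof.
move=> l0 [th [thc thE ->]] [th' [thc' thE' ->]].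
suff : th 0 - th' 0 = th l - th' l by lra.
apply: (@continuous_int_cst l (fun t => th t - th' t)) => //.
  apply/within_continuousP => x xl; apply: cvgB.
    by move/within_continuousP : thc; exact.
  by move/within_continuousP : thc'; exact.
move=> t tl; apply: e2pi_inj_mod.
have [p0 pE] := thE _ tl; have [_ pE'] := thE' _ tl.
by apply: (@mulfI _ `|phi t|); rewrite ?normr_eq0 // -pE.
Qed.

Lemma cvg_mul_conjc (T : Type) (F : set_system T) (FF : Filter F)
    (u v : T -> C^o) (a b : C^o) :
  u @ F --> a -> v @ F --> b ->
  (fun t => u t * ((v t)^*)%C : C^o) @ F --> (a * (b^*)%C : C^o).
Proof. move=> ua vb; exact: (@cvgM C _ _ FF _ _ _ _ ua (cvg_conjc FF vb)). Qed.

(* The quotient g / f stays in the right half plane, where the arcsine of the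
   imaginary part is a continuous branch of the argument. *)
Lemma arg_variation_close f g d :
  {within I, continuous (f : R -> C^o)} ->
  {within I, continuous (g : R -> C^o)} ->
  (forall t, I t -> `|f t| = 1) -> (forall t, I t -> `|g t| = 1) ->
  f 0 = g 0 -> f 1 = g 1 -> (forall t, I t -> `|f t - g t| < 1) ->
  arg_variation f 1 d -> arg_variation g 1 d.
Proof.
move=> /within_continuousP fc /within_continuousP gc f1 g1 fg0 fg1 fg.
move=> [th [/within_continuousP thc thE ->]].
pose q t := g t * ((f t)^*)%C.
have qE t : I t -> g t = f t * q t.
  move=> It; rewrite /q mulrCA -sqr_normc f1 // expr1n mulr1 //.
have q1 t : I t -> `|q t| = 1.
  by move=> It; rewrite normrM normcJ f1 // g1 // mulr1.
have q1lt t : I t -> `|1 - q t| < 1.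
  move=> It; have := fg _ It.
  by rewrite {1}(qE _ It) -{1}[f t]mulr1 -mulrBr normrM f1 // mul1r.
(* [|1 - q| < 1] makes the real part positive, so on the unit circle it is the positive root
   determined by the imaginary part. *)
have qIm t : I t -> -1 < complex.Im (q t) < 1 /\
    Num.sqrt (1 - complex.Im (q t) ^+ 2) = complex.Re (q t).
  move=> It; have := q1 _ It; have := q1lt _ It.
  case: (q t) => a b.
  rewrite -[1%R]/(1 +i* 0) => ab1.
  have a0 : 0 < a.
    have := le_lt_trans (normc_ge_Re _) ab1.
    by rewrite /= ltcR => /ltr_normlP[_]; lra.
  rewrite normc_def /= => -[ab'].
  have ab0 : 0 <= a ^+ 2 + b ^+ 2 by rewrite addr_ge0 ?sqr_ge0.
  have ab : a ^+ 2 + b ^+ 2 = 1.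
    by rewrite -[LHS](sqr_sqrtr ab0) ab' expr1n.
  have ba : 1 - b ^+ 2 = a ^+ 2 by rewrite -ab addrK.
  split; last by rewrite ba sqrtr_sqr gtr0_norm.
  rewrite -ltr_norml -(@expr_lt1 _ 2) // real_normK ?num_real //.
  by rewrite -[ltRHS]ab ltrDr exprn_gt0.
have pos : 2 * pi != 0 :> R by rewrite gt_eqF // twopi_gt0.
have asin0 : asin 0 = 0 :> R.
  rewrite -{1}sin0 sinK // in_itv /= oppr_le0 andbb.
  by rewrite divr_ge0 // pi_ge0.
(* The correction vanishes at both ends, where f = g, hence the variation is unchanged. *)
pose th' t := th t + asin (complex.Im (q t)) / (2 * pi).
have [I0 I1] := unit_itv_ends.
have th'E t : f t = g t -> I t -> th' t = th t.
  move=> fgt It; rewrite /th'.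
  have -> : q t = 1 by rewrite /q -fgt -sqr_normc f1 ?expr1n.
  by rewrite /= asin0 mul0r addr0.
exists th'; split; last by rewrite !th'E.
  apply/within_continuousP => t It; apply: cvgD; first exact: thc.
  apply: cvgM; last exact: cvg_cst.
  apply: (cvg_comp _ (@asin R)); last exact: (continuous_asin (qIm _ It).1).
  apply: cvg_Im; apply: cvg_mul_conjc; [exact: gc|exact: fc].
move=> t It.
have [_ fE] := thE _ It; have [/andP[/ltW i1 /ltW i2] qRe] := qIm _ It.
split; first by rewrite -normr_gt0 g1.
rewrite g1 // mul1r e2piD qE // {1}fE f1 // mul1r; congr (_ * _).
rewrite /e2pi [2 * pi * _]mulrC divfK // asinK ?in_itv /= ?i1 //.
by rewrite cos_asin ?i1 // qRe; case: (q t).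
Qed.

(** The parameters s whose slice has variation [d] form a relatively open and closed subset of the
    connected interval, because nearby slices are uniformly close. *)
Lemma arg_variation_homotopy (phi : R * R -> C) a b d :
  {within I `*` I, continuous (phi : R * R -> C^o)} ->
  (forall s t, I s -> I t -> `|phi (s, t)| = 1) ->
  (forall s, I s -> phi (s, 0) = phi (0, 0) /\ phi (s, 1) = phi (0, 1)) ->
  I a -> I b ->
  arg_variation (fun t => phi (a, t)) 1 d ->
  arg_variation (fun t => phi (b, t)) 1 d.
Proof.
move=> /within_continuousP phic phi1 phie Ia Ib.
have [I0 I1] := unit_itv_ends.
pose P s := arg_variation (fun t => phi (s, t)) 1 d.
have slice s : I s -> {within I, continuous (fun t => phi (s, t) : C^o)}.
  move=> Is; apply/within_continuousP => t It.
  move=> Q /(phic (s, t) (conj Is It)) -[[U V] /= [sU tV] UV].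
  apply: filterS tV => t' Vt' It'.
  by apply: (UV (s, t')) => //; split => //; exact: nbhs_singleton.
have local s : I s -> \forall s' \near s, I s' -> (P s <-> P s').
  move=> Is.
  (* Compactness in t gives a neighbourhood of s valid for all t at once. Near each t, both slices
     lie within 1/2 of [phi (s, t)]. *)
  have close : \forall s' \near s, I `<=`
     [set t | I s' -> `|phi (s, t) - phi (s', t)| < 1].
    have /compact_near_coveringP/near_covering_withinP K :
      compact I by exact: segment_compact.
    apply: (K _ (nbhs s) (fun s' t => I s' -> `|phi (s, t) - phi (s', t)| < 1)).
    move=> t It.
    have /cvgrPdist_lt /(_ (1 / 2)) := phic (s, t) (conj Is It).
    case=> [|[U V] /= [sU tV] UV]; first by rewrite divr_gt0.
    exists (V, U) => //= -[t' s'] /= [Vt' Us'] It' Is'.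
    have close_to r : U r -> I r -> `|phi (s, t) - phi (r, t')| < 1 / 2.
      by move=> Ur Ir; exact: (UV (r, t')).
    have near_s := close_to _ (nbhs_singleton sU) Is.
    have near_s' := close_to _ Us' Is'.
    rewrite -(subrKA (phi (s, t))) (le_lt_trans (ler_normD _ _)) //.
    by rewrite [1%R](splitr 1) ltrD // distrC.
  apply: filterS close => s' close Is'.
  have [e0 e1] := phie _ Is; have [e0' e1'] := phie _ Is'.
  split; apply: arg_variation_close => //; try exact: slice;
    try (by move=> t It; exact: phi1); rewrite ?e0 ?e1 ?e0' ?e1' //.
    by move=> t It; exact: close.
  by move=> t It; rewrite distrC; exact: close.
move=> Pa.
(* By [local], the open sets [U] and [V] cut out on the interval [P] and its complement. *)
pose U := [set s : R | \forall s' \near s, I s' -> P s'].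
pose V := [set s : R | \forall s' \near s, I s' -> ~ P s'].
have UP s : I s -> U s <-> P s.
  move=> Is; split=> [/nbhs_singleton|Ps]; first exact.
  by apply: filterS (local _ Is) => s' PP Is'; apply/PP.
have VP s : I s -> V s <-> ~ P s.
  move=> Is; split=> [/nbhs_singleton|Ps]; first exact.
  by apply: filterS (local _ Is) => s' PP Is' Ps'; apply/Ps/PP.
have openU : open U.
  by rewrite openE => s; exact: nbhs_interior.
have openV : open V.
  by rewrite openE => s; exact: nbhs_interior.
suff IP : I `&` [set s | P s] = I by move: Ib; rewrite -IP => -[].
apply: (@segment_connected R 0 1); first by exists a.
  exists U => //; apply/seteqP; split=> s -[Is Ps]; split=> //; exact/UP.
exists (~` V); first by rewrite closedC.
apply/seteqP; split=> s -[Is Ps]; split=> //; first by move/VP; exact.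
by apply: contrapT => nPs; apply: Ps; apply/VP.
Qed.

End Winding.

(** * The Robbin-Salamon index and the residue form *)

Section RobbinSalamonLoops.
Variable R : realType.
Local Notation C := R[i].
Local Notation I := (`[0, 1]%classic : set R).

Lemma det_conj m (M : 'M[C]_m) : \det (M^t*) = ((\det M)^*)%R.
Proof. by rewrite det_map_mx det_tr. Qed.

Lemma unitary_det_norm m (M : 'M[C]_m) : M \is unitarymx -> `|\det M| = 1.
Proof.
move=> /unitarymxP /(congr1 determinant); rewrite det_mulmx det1 det_conj.
rewrite -normCK => /eqP; rewrite sqrf_eq1 => /orP[/eqP //|/eqP].
by move=> M1; have := normr_ge0 (\det M); rewrite M1 lerNr oppr0 ler10.
Qed.

Lemma e2pi_sum (J : finType) (s : J -> R) :
  \prod_i e2pi (s i) = e2pi (\sum_i s i).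
Proof.
by rewrite (big_morph (@e2pi R) (@e2piD R) (@e2pi0 R)).
Qed.

(** For a loop, the model path also ends at 1, so every s_k is an integer and contributes 2 s_k. The
    determinant of the model path has phase t times the sum of the s_k, and the homotopy carries
    this winding number over to det A. *)
Lemma RS_index_loop m (A : R -> 'M[C]_m) r : A 1 = 1%:M ->
  RS_index A r -> arg_variation (fun t => \det (A t)) 1 (r / 2).
Proof.
move=> A1 [P [s [Pu [H [Hc Hu HA He]] ->]]].
have [I0 I1] := unit_itv_ends R.
have H1 : P *m diag_mx (\row_k e2pi (s k)) *m P^t* = 1%:M.
  have [_ H1] := HA _ I1; have [_] := He _ I1; rewrite H1 A1 => <-.
  by congr (_ *m diag_mx _ *m _); apply/rowP => k; rewrite !mxE mulr1.
have s_int k : s k \is a Num.int.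
  rewrite -e2pi_eq1.
  have : diag_mx (\row_k e2pi (s k)) = 1%:M.
    have Pu' : P^t* *m P = 1%:M by apply: mulmx1C; apply/unitarymxP.
    have := congr1 (fun M => P^t* *m M *m P) H1.
    by rewrite /= mulmx1 !mulmxA Pu' mul1mx -mulmxA Pu' mulmx1.
  by move/matrixP => /(_ k k); rewrite !mxE eqxx mulr1n => ->.
have -> : (\sum_k RS_U1 (s k)) / 2 = \sum_k s k.
  rewrite mulr_suml; apply: eq_bigr => k _.
  by rewrite /RS_U1 s_int mulrC mulKf ?pnatr_eq0.
pose phi (p : R * R) := \det (H p).
have det1 t : \det (P *m diag_mx (\row_k e2pi (s k * t)) *m P^t*) =
    e2pi ((\sum_k s k) * t).
  rewrite !det_mulmx det_conj mulrAC -normCK unitary_det_norm // expr1n.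
  rewrite mul1r det_diag mulr_suml -e2pi_sum; apply: eq_bigr => k _.
  by rewrite mxE.
have phi0 t : I t -> phi (0, t) = \det (A t).
  by move=> It; rewrite /phi (HA _ It).1.
have phi1 t : I t -> phi (1, t) = e2pi ((\sum_k s k) * t).
  by move=> It; rewrite /phi (HA _ It).2 det1.
have : arg_variation (fun t => phi (0, t)) 1 (\sum_k s k).
  (* The homotopy is followed backwards, from the model path at parameter 1 to [A] at parameter
     0. *)
  apply: (@arg_variation_homotopy _ _ 1) => //.
  - move/within_continuousP : Hc => Hc; apply/within_continuousP => x xI.
    exact: (cvg_det _ (Hc _ xI)).
  - by move=> a t Ia It; rewrite /phi unitary_det_norm // Hu.
  - move=> a Ia; rewrite /phi (He _ Ia).1 (He _ Ia).2.
    by rewrite (He _ I0).1 (He _ I0).2.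
  exists (fun t => (\sum_k s k) * t); split; last by rewrite mulr0 mulr1 subr0.
    apply: continuous_subspaceT => t.
    by apply: cvgM; [exact: cvg_cst|exact: cvg_id].
  move=> t It; rewrite phi1 // e2pi_neq0 e2pi_norm mul1r.
  by split.
case=> th [thc thE ->]; exists th; split=> // t It.
by rewrite -phi0 //; exact: thE.
Qed.
End RobbinSalamonLoops.

(** * The residue form in unitary frames and along the Reeb flow *)

Section ResidueForm.
Variables (R : realType) (m : nat) (W : mpoly.mpoly m.+1 R[i]).
Local Notation C := R[i].
Implicit Types (p : 'cV[C]_m.+1) (U V F : 'M[C]_(m.+1, m)).

Definition grad_sqnorm p : C := \sum_j `|pderiv W j p| ^+ 2.

Lemma grad_sqnormJ p : ((grad_sqnorm p)^*)%R = grad_sqnorm p.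
Proof.
by rewrite /grad_sqnorm rmorph_sum; apply: eq_bigr => i _;
  rewrite rmorphXn /= conj_normC.
Qed.

(** The Hermitian product with the conormal is dW up to a scalar; in particular the conormal is
    orthogonal to ker dW. *)
Lemma conormal_dual p k (V : 'M[C]_(m.+1, k)) :
  (conormal W p)^t* *m V =
  (grad_sqnorm p)^-1 *: \row_j dpeval W p (col j V).
Proof.
apply/rowP => j; rewrite !mxE /dpeval mulr_sumr; apply: eq_bigr => i _.
rewrite !mxE rmorphM fmorphV -/(grad_sqnorm p) /= grad_sqnormJ conjCK.
by rewrite mulrAC mulrC.
Qed.

Lemma conormal_sqnorm p :
  (conormal W p)^t* *m conormal W p = ((grad_sqnorm p)^-1)%:M.
Proof.
rewrite conormal_dual [LHS]mx11_scalar !mxE; congr (_%:M).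
have [->|N0] := eqVneq (grad_sqnorm p) 0; first by rewrite invr0 mul0r.
rewrite -[RHS]mulr1; congr (_ * _); rewrite -[RHS](mulfV N0).
rewrite {2}/grad_sqnorm mulr_suml; apply: eq_bigr => i _.
by rewrite !mxE mulrA -normCK.
Qed.

(** Border [F] and [V] by the conormal: as it is orthogonal to both, the matrix of Hermitian
    products is block diagonal, and its determinant gives the formula. For [F = V] unitary it yields
    the modulus of the residue form; otherwise it compares phases. *)
Lemma residue_form_mul p F V :
  (forall k, dpeval W p (col k F) = 0) ->
  (forall k, dpeval W p (col k V) = 0) ->
  (residue_form W p F)^* * residue_form W p V =
  (grad_sqnorm p)^-1 * \det (F^t* *m V).
Proof.
move=> F0 V0.
have nu0 U : (forall k, dpeval W p (col k U) = 0) ->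
    (conormal W p)^t* *m U = 0.
  by move=> U0; rewrite conormal_dual; apply/rowP => j; rewrite !mxE U0 mulr0.
have Fnu : F^t* *m conormal W p = 0.
  by rewrite -[LHS]trmxCK trmx_mul map_mxM trmxCK nu0 // trmx0 map_mx0.
have -> : ((residue_form W p F)^*)%R =
    \det ((row_mx (conormal W p) F : 'M[C]_m.+1) ^t*) by rewrite det_conj.
rewrite /residue_form -det_mulmx (_ : _ *m _ =
  (block_mx ((grad_sqnorm p)^-1)%:M 0 0 (F^t* *m V) : 'M[C]_(1 + m)));
    last first.
  rewrite (@tr_row_mx C m.+1 1 m) (@map_col_mx _ _ _ 1 m).
  by rewrite (@mul_col_row _ 1 m m.+1 1 m) conormal_sqnorm nu0 // Fnu.
by rewrite (@det_ublock _ 1 m) det_scalar1.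
Qed.

Variables (w : 'I_m.+1 -> nat) (h : nat).
Hypothesis W_homogeneous : weighted_homogeneous W w h.

(** The flow is a weighted scaling by a unit complex number, so the homogeneity lemmas apply to
    it. *)
Lemma reeb_flowE (t : R) :
  reeb_flow w h t = weight_scaling w (e2pi (t / h%:R)).
Proof. by apply/rowP => i; rewrite !mxE e2piMn mulrA. Qed.

Let h_neq0 : h%:R != 0 :> R.
Proof. by rewrite pnatr_eq0 -lt0n (degree_gt0 W_homogeneous). Qed.

Lemma e2pi_degree (t : R) : e2pi (t / h%:R) ^+ h = e2pi t.
Proof. by rewrite e2piMn mulrC divfK. Qed.

Lemma dpeval_reeb_flow t p v :
  dpeval W (diag_mx (reeb_flow w h t) *m p) (diag_mx (reeb_flow w h t) *m v) =
  e2pi t * dpeval W p v.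
Proof.
by rewrite reeb_flowE (dpeval_homogeneous W_homogeneous) e2pi_degree.
Qed.

Lemma pderiv_reeb_flow t p i :
  pderiv W i (diag_mx (reeb_flow w h t) *m p) =
  e2pi t * (reeb_flow w h t 0 i)^-1 * pderiv W i p.
Proof.
rewrite mulrAC -[LHS](mulfK (e2pi_neq0 ((w i)%:R * t / h%:R))) !mxE.
congr (_ / _); rewrite -(e2pi_degree t) -(pderiv_homogeneous W_homogeneous).
by rewrite reeb_flowE e2piMn mulrA.
Qed.

Lemma grad_sqnorm_reeb_flow t p :
  grad_sqnorm (diag_mx (reeb_flow w h t) *m p) = grad_sqnorm p.
Proof.
apply: eq_bigr => i _; rewrite pderiv_reeb_flow !normrM normfV !mxE !e2pi_norm.
by rewrite invr1 !mul1r.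
Qed.

Lemma conormal_reeb_flow t p :
  conormal W (diag_mx (reeb_flow w h t) *m p) =
  e2pi (- t) *: (diag_mx (reeb_flow w h t) *m conormal W p).
Proof.
apply/colP => i; rewrite [LHS]mxE -/(grad_sqnorm _) grad_sqnorm_reeb_flow.
rewrite pderiv_reeb_flow [RHS]mxE mul_diag_mxE !rmorphM fmorphV /= !mxE.
by rewrite !e2pi_conj invrK e2piN -/(grad_sqnorm _) !mulrA.
Qed.

(** The determinant of the flow contributes the sum of the w_i / h to the phase; the conormal
    column, rescaled by [e2pi (- t)] because W is multiplied by [e2pi t], contributes -1. *)
Lemma residue_form_reeb_flow t p V :
  residue_form W (diag_mx (reeb_flow w h t) *m p)
    (diag_mx (reeb_flow w h t) *m V) =
  e2pi ((\sum_i (w i)%:R / h%:R - 1) * t) * residue_form W p V.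
Proof.
rewrite /residue_form conormal_reeb_flow.
have -> : row_mx (e2pi (- t) *: (diag_mx (reeb_flow w h t) *m conormal W p))
    (diag_mx (reeb_flow w h t) *m V) =
  diag_mx (reeb_flow w h t) *m (row_mx (conormal W p) V *m
    (block_mx (e2pi (- t))%:M 0 0 1%:M : 'M[C]_(1 + m))).
  rewrite mul_row_block !mulmx0 !mulmx1 addr0 add0r mul_mx_scalar.
  by rewrite mul_mx_row -scalemxAr.
rewrite (@det_mulmx C m.+1) (@det_mulmx C m.+1) (@det_ublock _ 1 m).
rewrite det_scalar1 det1.
rewrite mulr1 [X in _ * X]mulrC mulrA; congr (_ * _).
rewrite det_diag (eq_bigr (fun i => e2pi ((w i)%:R / h%:R * t))) => [|i _].
  by rewrite e2pi_sum -e2piD mulrBl mul1r mulr_suml.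
by rewrite mxE mulrAC.
Qed.

End ResidueForm.

(** * The index of a principal orbit in an arbitrary unitary frame *)

Section PrincipalOrbits.
Variables (R : realType) (m : nat) (W : mpoly.mpoly m.+1 R[i]).
Variables (w : 'I_m.+1 -> nat) (h : nat).
Hypothesis W_homogeneous : weighted_homogeneous W w h.
Local Notation C := R[i].
Local Notation I := (`[0, 1]%classic : set R).
Local Notation Jinv := (map_mx GRing.inv (monodromy R w h) : 'rV[C]_m.+1).
Local Notation lambda := (\sum_i (w i)%:R / h%:R - 1 : R).
Implicit Types (p : 'cV[C]_m.+1).

Lemma reeb_flow0 : reeb_flow w h 0 = const_mx 1 :> 'rV[C]_m.+1.
Proof. by apply/rowP => i; rewrite !mxE mulr0 mul0r e2pi0. Qed.

Lemma diag_reeb_flow0 : diag_mx (reeb_flow w h 0) = 1%:M :> 'M[C]_m.+1.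
Proof. by rewrite reeb_flow0 diag_const_mx. Qed.

Lemma monodromy_invK k (V : 'M[C]_(m.+1, k)) :
  diag_mx (reeb_flow w h 1) *m (diag_mx Jinv *m V) = V.
Proof.
apply/matrixP => i j; rewrite !mul_diag_mx !mxE mulr1.
by rewrite mulrA mulfV ?mul1r // e2pi_neq0.
Qed.

Lemma principal_twist k (V : 'M[C]_(m.+1, k)) :
  diag_mx Jinv *m (diag_mx (reeb_flow w h 1) *m V) = V.
Proof.
apply/matrixP => i j; rewrite !mul_diag_mx !mxE mulr1.
by rewrite mulrA mulVf ?mul1r // e2pi_neq0.
Qed.

Lemma principal_orbit_RS_index p mu :
  orbit_RS_index W w h Jinv 1 p mu -> mu = 2 * lambda.
Proof.
case=> F [r [d [[_ F_tangent F_twist] RSr [th [thc thE ->]] ->]]].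
have [I0 I1] := unit_itv_ends R.
pose A t := linearized_flow w h F (1 * t).
(* The twist condition says that the time-1 flow maps [F 0] to [F 1], so [A] is a loop. *)
have A1 : A 1 = 1%:M.
  rewrite /A mulr1 /linearized_flow -F_twist monodromy_invK.
  by have [_] := F_tangent _ I1.
have dA := RS_index_loop A1 RSr.
(* Uniqueness of the variation identifies r / 2 with this value, and adding the variation of [th]
   twice cancels the dependence on the frame. *)
suff dA' : arg_variation (fun t => \det (A t)) 1 (lambda - (th 1 - th 0)).
  by have := arg_variation_uniq ler01 dA dA' => /eqP; lra.
pose Om t := residue_form W (diag_mx (reeb_flow w h t) *m p) (F t).
(* With a zero gradient, the product formula would make the residue form vanish, since the inverse
   of 0 is 0; [arg_variation] excludes this. *)
have N0 : grad_sqnorm W p != 0.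
  have /(residue_form_mul (F_tangent _ I0).1) := (F_tangent _ I0).1.
  rewrite (grad_sqnorm_reeb_flow W_homogeneous) (F_tangent _ I0).2 det1 mulr1.
  move=> E; apply/eqP => N0; move: E; rewrite N0 invr0 => /eqP.
  by rewrite mulf_eq0 fmorph_eq0 orbb; apply/negP; exact: (thE _ I0).1.
(* Unitarity of the frame and invariance of the gradient norm make the modulus of [Om] constant:
   only its phase [th] varies. *)
have Om2 t : I t -> `|Om t| ^+ 2 = (grad_sqnorm W p)^-1.
  move=> It; rewrite normCKC residue_form_mul; try exact: (F_tangent _ It).1.
  rewrite (grad_sqnorm_reeb_flow W_homogeneous) (F_tangent _ It).2.
  by rewrite det1 mulr1.
have OmE t : I t -> Om t = `|Om 0| * e2pi (th t).
  move=> It; rewrite {1}/Om (thE _ It).2 -/(Om t); congr (_ * _).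
  apply/eqP; rewrite -(@eqrXn2 _ 2) //; apply/eqP.
  by rewrite !Om2.
have detA t : I t -> \det (A t) = e2pi (lambda * t + th 0 - th t).
  move=> It.
  have RF0 k : dpeval W (diag_mx (reeb_flow w h t) *m p)
      (col k (diag_mx (reeb_flow w h t) *m F 0)) = 0.
    rewrite colE -mulmxA -colE (dpeval_reeb_flow W_homogeneous).
    have := (F_tangent _ I0).1 k.
    by rewrite diag_reeb_flow0 mul1mx => ->; rewrite mulr0.
  have := residue_form_mul (F_tangent _ It).1 RF0.
  rewrite (residue_form_reeb_flow W_homogeneous).
  have -> : residue_form W p (F 0) = Om 0.
    by rewrite /Om diag_reeb_flow0 mul1mx.
  rewrite -/(Om t) (OmE _ It) {2}(OmE _ I0).
  rewrite (grad_sqnorm_reeb_flow W_homogeneous).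
  rewrite -/(linearized_flow w h F t) => E; rewrite /A mul1r.
  apply: (mulfI (invr_neq0 N0)); rewrite -E -(Om2 _ I0) !e2piD e2piN.
  by rewrite rmorphM /= conj_normC e2pi_conj; ring.
exists (fun t => lambda * t + th 0 - th t); split; last first.
- by rewrite mulr0 mulr1; ring.
- move=> t It; rewrite detA // e2pi_neq0 e2pi_norm mul1r.
  by split.
apply/within_continuousP => t It; apply: cvgB.
  apply: cvg_within_filter; apply: cvgD; last exact: cvg_cst.
  by apply: cvgM; [exact: cvg_cst|exact: cvg_id].
by move/within_continuousP : thc; exact.
Qed.

End PrincipalOrbits.

(** The kernel of a nonzero linear form has dimension m; Gram-Schmidt on a basis of it gives the
    frame. *)
Lemma unitary_kernel_frame (C : numClosedFieldType) m (a : 'rV[C]_m.+1) :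
  a != 0 -> exists F : 'M[C]_(m.+1, m), a *m F = 0 /\ F^t* *m F = 1%:M.
Proof.
move=> a0.
have rk : \rank (kermx a^T) = m.
  by rewrite mxrank_ker mxrank_tr rank_rV a0 subn1.
have : exists B : 'M[C]_(\rank (kermx a^T), m.+1),
    B *m a^T = 0 /\ B *m B^t* = 1%:M.
  exists (schmidt (row_base (kermx a^T))); split; last first.
    by apply/unitarymxP/schmidt_unitarymx; exact: rank_leq_row.
  apply/sub_kermxP; rewrite eqmx_schmidt_free ?row_base_free //.
  by rewrite eq_row_base.
rewrite rk => -[B [Ba Bu]]; exists B^T; split.
  by apply: trmx_inj; rewrite trmx_mul trmxK trmx0.
rewrite trmxK; have := congr1 (map_mx Num.conj) Bu.
rewrite /= map_mxM map_mx1 => <-; congr (_ *m _).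
by apply/matrixP => i j; rewrite !mxE /= conjCK.
Qed.

(** * Realization of the index by a flow-invariant frame *)

Section PrincipalOrbitsExist.
Variables (R : realType) (m : nat) (W : mpoly.mpoly m.+1 R[i]).
Variables (w : 'I_m.+1 -> nat) (h : nat).
Hypothesis W_homogeneous : weighted_homogeneous W w h.
Local Notation C := R[i].
Local Notation I := (`[0, 1]%classic : set R).
Local Notation Jinv := (map_mx GRing.inv (monodromy R w h) : 'rV[C]_m.+1).
Local Notation lambda := (\sum_i (w i)%:R / h%:R - 1 : R).
Implicit Types (p : 'cV[C]_m.+1).

Lemma grad_sqnorm_eq0 p :
  (grad_sqnorm W p == 0) = [forall i, pderiv W i p == 0].
Proof.
rewrite /grad_sqnorm psumr_eq0 => [|i _]; last by rewrite exprn_ge0.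
apply/allP/forallP => H i; last by rewrite (eqP (H i)) normr0 expr0n /= eqxx.
by have := H i (mem_index_enum i); rewrite /= sqrf_eq0 normr_eq0.
Qed.

Lemma dpeval_row p (v : 'cV[C]_m.+1) :
  dpeval W p v = ((\row_i pderiv W i p) *m v) 0 0.
Proof. by rewrite mxE; apply: eq_bigr => i _; rewrite mxE. Qed.

Lemma reeb_flow_unitary (t : R) :
  (diag_mx (reeb_flow w h t))^t* *m diag_mx (reeb_flow w h t)
  = 1%:M :> 'M[C]_m.+1.
Proof.
rewrite tr_diag_mx map_diag_mx mulmx_diag -diag_const_mx; congr diag_mx.
apply/rowP => i; rewrite !mxE /=; set e := e2pi _.
by rewrite -normCKC e2pi_norm expr1n.
Qed.

(** Transport a unitary frame of ker dW at p by the flow. The linearized flow becomes constant, of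
    index 0, and the phase of the residue form is affine in t with slope [lambda]. *)
Lemma principal_orbit_RS_index_exists p : grad_sqnorm W p != 0 ->
  orbit_RS_index W w h Jinv 1 p (2 * lambda).
Proof.
move=> N0.
have [|F0 [aF0 F0u]] := @unitary_kernel_frame C m (\row_i pderiv W i p).
  apply: contra N0 => /eqP/rowP a0; rewrite grad_sqnorm_eq0.
  by apply/forallP => i; have := a0 i; rewrite !mxE => ->.
have dF0 k : dpeval W p (col k F0) = 0.
  by rewrite dpeval_row colE mulmxA aF0 mul0mx mxE.
pose F t := diag_mx (reeb_flow w h t) *m F0.
have Fu t : (F t)^t* *m F t = 1%:M.
  rewrite /F trmx_mul map_mxM mulmxA -[_ *m _ *m diag_mx _]mulmxA.
  by rewrite reeb_flow_unitary mulmx1.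
have Om2 : `|residue_form W p F0| ^+ 2 = (grad_sqnorm W p)^-1.
  by rewrite normCKC residue_form_mul // F0u det1 mulr1.
have Om0 : residue_form W p F0 != 0.
  by rewrite -normr_eq0 -sqrf_eq0 Om2 invr_eq0.
have [x xE] := polar_form (residue_form W p F0).
exists F, 0, lambda; split; last by rewrite add0r.
- split=> [|t _|]; last by rewrite /F principal_twist diag_reeb_flow0 mul1mx.
    apply: continuous_subspaceT => t; apply: cvg_mx => i j.
    rewrite /F mul_diag_mx mxE; under eq_cvg do rewrite mul_diag_mx mxE.
    apply: (@cvgM C); last exact: cvg_cst.
    rewrite mxE; under eq_cvg do rewrite mxE.
    apply: cvg_e2pi; apply: cvgM; last exact: cvg_cst.
    by apply: cvgM; [exact: cvg_cst|exact: cvg_id].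
  split; last exact: Fu.
  move=> k; rewrite /F colE -mulmxA -colE (dpeval_reeb_flow W_homogeneous).
  by rewrite dF0 mulr0.
- have A1 t : linearized_flow w h F (1 * t) = 1%:M.
    by rewrite mul1r /linearized_flow {2}/F diag_reeb_flow0 mul1mx Fu.
  have B1 t : 1%:M *m diag_mx (\row_(k < m) e2pi (0 * t)) *m (1%:M)^t* = 1%:M
      :> 'M[C]_m.
    rewrite mul1mx trmx1 map_mx1 mulmx1 -diag_const_mx; congr diag_mx.
    by apply/rowP => k; rewrite !mxE mul0r e2pi0.
  exists 1%:M, (fun=> 0); split.
  + by apply/unitarymxP; rewrite mul1mx trmx1 map_mx1.
  + exists (fun=> 1%:M); split=> *.
    * by apply: continuous_subspaceT => ?; exact: cvg_cst.
    * by apply/unitarymxP; rewrite mul1mx trmx1 map_mx1.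
    * by rewrite A1 B1.
    * by rewrite !A1.
  + by rewrite big1 // => k _; rewrite /RS_U1 int_num0 mulr0.
- exists (fun t => lambda * t + x); split.
  + apply: continuous_subspaceT => t; apply: cvgD; last exact: cvg_cst.
    by apply: cvgM; [exact: cvg_cst|exact: cvg_id].
  + move=> t _; rewrite /F (residue_form_reeb_flow W_homogeneous).
    split; first by rewrite mulf_neq0 // e2pi_neq0.
    by rewrite normrM e2pi_norm mul1r {1}xE e2piD mulrCA.
  + by rewrite mulr1 mulr0; ring.
Qed.

End PrincipalOrbitsExist.

(** * The link and its dimension *)

Section Realification.
Variables (R : realType) (n : nat).
Local Notation C := R[i].
Implicit Types (v : 'cV[C]_n) (u : 'rV[C]_n) (x : 'rV[R]_(n + n)).

Definition realify v : 'rV[R]_(n + n) :=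
  row_mx (\row_i complex.Re (v i 0)) (\row_i complex.Im (v i 0)).

Definition complexify x : 'cV[C]_n :=
  \col_i (x 0 (lshift n i) +i* x 0 (rshift n i)).

(** The real form v |-> Re (u v) in the coordinates of [realify]; the sign comes from Re (a b) = Re
    a Re b - Im a Im b. *)
Definition real_part_form u : 'cV[R]_(n + n) :=
  col_mx (\col_i complex.Re (u 0 i)) (\col_i - complex.Im (u 0 i)).

Lemma realifyEl v i : realify v 0 (lshift n i) = complex.Re (v i 0).
Proof. by rewrite row_mxEl mxE. Qed.

Lemma realifyEr v i : realify v 0 (rshift n i) = complex.Im (v i 0).
Proof. by rewrite row_mxEr mxE. Qed.

Lemma realifyK : cancel realify complexify.
Proof.
move=> v; apply/colP => i; rewrite mxE realifyEl realifyEr.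
by case: (v i 0).
Qed.

Lemma complexifyK : cancel complexify realify.
Proof.
move=> x; apply/rowP => i; rewrite -(splitK i) /unsplit.
by case: splitP => j _; rewrite ?realifyEl ?realifyEr mxE.
Qed.

Lemma realify_sum d (c : 'rV[R]_d) (b : 'I_d -> 'cV[C]_n) :
  realify (\sum_k (c 0 k)%:C *: b k) = c *m \matrix_k realify (b k).
Proof.
have entry k j : (\matrix_k realify (b k)) k j = realify (b k) 0 j.
  by rewrite mxE.
rewrite -[RHS]complexifyK; congr realify.
apply/colP => i; rewrite summxE !mxE; apply/eqP.
rewrite eq_complex !raddf_sum.
apply/andP; split; apply/eqP; apply: eq_bigr => k _;
  rewrite entry ?realifyEl ?realifyEr mxE;
  by case: (b k i 0) => ? ? /=; rewrite mul0r ?subr0 ?addr0.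
Qed.

Lemma real_part_formE u v :
  complex.Re ((u *m v) 0 0) = (realify v *m real_part_form u) 0 0.
Proof.
rewrite mul_row_col !mxE raddf_sum -big_split; apply: eq_bigr => i _ /=.
by rewrite !mxE; case: (u 0 i) (v i 0) => [a b] [c d] /=; ring.
Qed.

Lemma real_part_formEu u i :
  real_part_form u (lshift n i) 0 = complex.Re (u 0 i).
Proof. by rewrite col_mxEu mxE. Qed.

Lemma real_part_formEd u i :
  real_part_form u (rshift n i) 0 = - complex.Im (u 0 i).
Proof. by rewrite col_mxEd mxE. Qed.

Lemma real_part_form_eq0 u : real_part_form u = 0 -> u = 0.
Proof.
move=> /colP u0; apply/rowP => i; rewrite mxE.
have := u0 (lshift n i); have := u0 (rshift n i).
rewrite real_part_formEu real_part_formEd !mxE; case: (u 0 i) => a b /= /eqP.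
by rewrite oppr_eq0 => /eqP -> ->.
Qed.

Lemma real_part_form_sum k (c : 'I_k -> R) (u : 'I_k -> 'rV[C]_n) :
  real_part_form (\sum_j (c j)%:C *: u j) = \sum_j c j *: real_part_form (u j).
Proof.
have scale_entry j i :
    (c j *: real_part_form (u j)) i 0 = c j * real_part_form (u j) i 0.
  by rewrite mxE.
apply/colP => i; rewrite summxE (eq_bigr _ (fun j _ => scale_entry j i)).
rewrite -(splitK i) /unsplit; case: splitP => l _.
  rewrite real_part_formEu summxE raddf_sum; apply: eq_bigr => j _.
  by rewrite mxE real_part_formEu; case: (u j 0 l) => a b /=; ring.
rewrite real_part_formEd summxE raddf_sum -sumrN; apply: eq_bigr => j _.
by rewrite mxE real_part_formEd; case: (u j 0 l) => a b /=; ring.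
Qed.

Section Kernel.
Variables (k : nat) (u : 'I_k -> 'rV[C]_n) (V : set 'cV[C]_n).
Hypothesis VP : forall v, V v <-> forall j, complex.Re ((u j *m v) 0 0) = 0.
Hypothesis u_free : forall c : 'I_k -> R,
  \sum_j (c j)%:C *: u j = 0 -> forall j, c j = 0.

(** The columns are the k defining forms; vectors being rows, [V] becomes the left kernel. *)
Let K : 'M[R]_(n + n, k) := (\matrix_j (real_part_form (u j))^T)^T.

Lemma kernel_realify v : V v <-> (realify v <= kermx K)%MS.
Proof.
have E j : (realify v *m K) 0 j = complex.Re ((u j *m v) 0 0).
  rewrite real_part_formE !mxE; apply: eq_bigr => i _.
  by rewrite !mxE.
rewrite VP; split=> [v0|/sub_kermxP vK j]; last by rewrite -E vK mxE.
by apply/sub_kermxP/rowP => j; rewrite E v0 mxE.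
Qed.

Lemma rank_kernel : (\rank (kermx K) + k = n + n)%N.
Proof.
rewrite mxrank_ker mxrank_tr.
suff free : row_free (\matrix_j (real_part_form (u j))^T).
  by have := rank_leq_col (\matrix_j (real_part_form (u j))^T);
    rewrite (eqP free) => /subnK.
apply: inj_row_free => c c0; apply/rowP => j; rewrite mxE.
apply: (u_free (c := fun j => c 0 j)); apply: real_part_form_eq0.
rewrite real_part_form_sum; apply: trmx_inj; rewrite trmx0 -c0 mulmx_sum_row.
by rewrite raddf_sum; apply: eq_bigr => i _; rewrite rowK /= linearZ.
Qed.

(** Uniqueness of the coordinates of 0 gives freeness, and the basis spans the kernel, whose rank
    follows from rank-nullity. *)
Lemma real_basis_dim d (b : 'I_d -> 'cV[C]_n) :
  real_basis V b -> (d + k = n + n)%N.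
Proof.
move=> bV; pose B := \matrix_k realify (b k).
have combE (c : 'rV[R]_d) v :
    v = \sum_k (c 0 k)%:C *: b k <-> realify v = c *m B.
  rewrite -realify_sum; split=> [-> //|]; exact: (can_inj realifyK).
have realify0 : realify 0 = 0.
  by apply/rowP => i; rewrite -(splitK i) /unsplit;
    case: splitP => j _; rewrite ?realifyEl ?realifyEr !mxE.
have Bfree : row_free B.
  apply: inj_row_free => c cB.
  have /bV[c' [_ c'_uniq]] : V 0.
    by apply/kernel_realify; rewrite realify0 sub0mx.
  rewrite -(c'_uniq c); last by apply/combE; rewrite realify0 cB.
  by apply: c'_uniq; apply/combE; rewrite realify0 mul0mx.
suff BK : (B :=: kermx K)%MS by rewrite -rank_kernel -BK (eqP Bfree).
apply/eqmxP/andP; split; apply/row_subP => i.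
  rewrite rowK; apply/kernel_realify/bV.
  exists (delta_mx 0 i); split; first by apply/combE; rewrite -rowE rowK.
  move=> c /combE cE; apply: (row_free_inj Bfree).
  by rewrite -cE -rowE rowK.
have /bV[c [/combE + _]] : V (complexify (row i (kermx K))).
  by apply/kernel_realify; rewrite complexifyK row_sub.
by rewrite complexifyK => ->; exact: submxMl.
Qed.

Lemma real_basis_exists : exists d (b : 'I_d -> 'cV[C]_n), real_basis V b.
Proof.
pose B := row_base (kermx K).
exists (\rank (kermx K)), (fun i => complexify (row i B)) => v.
have combE (c : 'rV[R]__) :
    v = \sum_k (c 0 k)%:C *: complexify (row k B) <-> realify v = c *m B.
  have <- : realify (\sum_k (c 0 k)%:C *: complexify (row k B)) = c *m B.
    rewrite realify_sum; congr (_ *m _); apply/row_matrixP => i.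
    by rewrite rowK complexifyK.
  by split=> [-> //|]; exact: (can_inj realifyK).
rewrite kernel_realify -(eq_row_base (kermx K)) -/B.
split=> [/submxP[c vE]|[c [/combE -> _]]]; last exact: submxMl.
exists c; split; first exact/combE.
move=> c' /combE; rewrite vE; apply: row_free_inj.
exact: row_base_free.
Qed.

End Kernel.
End Realification.

(** * Nonsingularity and nonemptiness of the link *)

Section Links.
Variables (R : realType) (m : nat) (W : mpoly.mpoly m.+1 R[i]).
Variables (w : 'I_m.+1 -> nat) (h : nat).
Hypothesis W_homogeneous : weighted_homogeneous W w h.
Local Notation C := R[i].
Implicit Types (p z : 'cV[C]_m.+1).

Let h_gt0 : (0 < h)%N := degree_gt0 W_homogeneous.
Let w_gt0 i : (0 < w i)%N := weight_gt0 W_homogeneous i.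

Lemma weight_scaling_eq0 (x : C) p : x != 0 ->
  (diag_mx (weight_scaling w x) *m p == 0) = (p == 0).
Proof.
move=> x0; apply/eqP/eqP => [/colP xp0|->]; last by rewrite mulmx0.
apply/colP => i; have /eqP := xp0 i.
by rewrite mul_diag_mxE !mxE mulf_eq0 expf_eq0 (negPf x0) andbF => /eqP.
Qed.

Lemma singular_point_scaling (x : C) p : x != 0 ->
  singular_point W p -> singular_point W (diag_mx (weight_scaling w x) *m p).
Proof.
move=> x0 [Wp dWp]; split=> [|i].
  by rewrite (homogeneity W_homogeneous) Wp mulr0.
apply: (mulIf (expf_neq0 (w i) x0)).
by rewrite (pderiv_homogeneous W_homogeneous) dWp mulr0 mul0r.
Qed.

(** Weighted scaling by small x > 0 would move a nonzero singular point through singular points into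
    the origin, which is an isolated one. *)
Lemma isolated_gradient_neq0 p : isolated_singularity0 W ->
  p != 0 -> peval W p = 0 -> grad_sqnorm W p != 0.
Proof.
case=> _ isol p0 Wp; apply/negP; rewrite grad_sqnorm_eq0 => /forallP dWp.
have sing : singular_point W p by split=> // i; apply/eqP.
pose f (x : R) : 'cV[C^o]_m.+1 := diag_mx (weight_scaling w x%:C) *m p.
have f0 : f 0 = 0.
  apply/colP => i; rewrite mul_diag_mxE !mxE -rmorphXn expr0n.
  by rewrite eqn0Ngt w_gt0 mul0r.
have fc : f x @[x --> (0 : R)] --> (0 : 'cV[C^o]_m.+1).
  rewrite -f0; apply: cvg_mx => i j; rewrite ord1 mul_diag_mxE !mxE.
  under eq_cvg do rewrite mul_diag_mxE !mxE.
  apply: (@cvgM C); last exact: cvg_cst.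
  rewrite -rmorphXn; under eq_cvg do rewrite -rmorphXn.
  by apply: cvg_real_complex; exact: exprn_continuous.
have : \forall x \near (0 : R)^'+, False.
  near=> x.
  have x0 : x%:C != 0 :> C by rewrite fmorph_eq0 gt_eqF.
  have : f x != 0 -> ~ singular_point W (f x).
    by near: x; exact: (cvg_at_right_filter fc isol).
  rewrite weight_scaling_eq0 // => /(_ p0); apply.
  exact: singular_point_scaling.
by case/filter_ex.
Unshelve. all: by end_near. Qed.

(** Restrict W to a coordinate plane. Either y |-> W(1, y) has a root, or it is a nonzero constant
    c; then W(x^w0, 1) = c x^h by homogeneity, and x = 0 gives W(0, 1) = 0. *)
Lemma nonzero_zero : (0 < m)%N -> exists2 z, z != 0 & peval W z = 0.
Proof.
move=> m0; pose i0 : 'I_m.+1 := ord0; pose i1 : 'I_m.+1 := ord_max.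
have i10 : i1 != i0 by rewrite -val_eqE /= -lt0n.
pose pt (a b : C) : 'cV[C]_m.+1 :=
  \col_i (if i == i0 then a else if i == i1 then b else 0).
pose u (a b : {poly C}) i := if i == i0 then a else if i == i1 then b else 0.
have uE a b x : (mpoly.mmap polyC (u a b) W).[x] = peval W (pt a.[x] b.[x]).
  rewrite mmap_curve; congr (peval W _); apply/colP => i; rewrite !mxE /u.
  by case: ifP => // _; case: ifP => // _; rewrite horner0.
have pt0 a b : (pt a b == 0) = (a == 0) && (b == 0).
  apply/eqP/andP => [/colP E|[/eqP -> /eqP ->]].
    by have := E i0; have := E i1; rewrite !mxE !eqxx (negPf i10) => -> ->.
  by apply/colP => i; rewrite !mxE; do 2?case: ifP.
pose Q := mpoly.mmap polyC (u 1 'X) W.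
have [|] := boolP (size Q != 1%N).
  move=> /closed_rootP[y /rootP]; rewrite uE hornerC hornerX => Wy.
  by exists (pt 1 y) => //; rewrite pt0 oner_eq0.
rewrite negbK => /size_poly1P[c c0 Qc].
have Wc y : peval W (pt 1 y) = c.
  by have := uE 1 'X y; rewrite -/Q Qc !hornerC hornerX.
exists (pt 0 1); first by rewrite pt0 oner_eq0 andbF.
pose T := mpoly.mmap polyC (u 'X^(w i0) 1) W.
have TE : T = c *: 'X^h.
  (* The scaling argument requires k to be nonzero; multiplying by X settles k = 0. *)
  apply/eqP; rewrite -subr_eq0 -(mulrI_eq0 _ (mulfI (negbT (polyX_eq0 _)))).
  apply/eqP/poly_nat_roots => k.
  rewrite hornerM hornerX hornerD hornerN uE hornerXn hornerC hornerZ hornerXn.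
  have [->|k0] := eqVneq (k%:R : C) 0; first by rewrite mul0r.
  have -> : pt (k%:R ^+ w i0) 1 =
      diag_mx (weight_scaling w k%:R) *m pt 1 (k%:R ^- w i1).
    apply/colP => i; rewrite mul_diag_mxE !mxE.
    case: eqVneq => [->|_]; first by rewrite mulr1.
    case: eqVneq => [->|_]; last by rewrite mulr0.
    by rewrite mulfV // expf_neq0.
  by rewrite (homogeneity W_homogeneous) Wc mulrC [c * _]mulrC subrr mul0r.
have := uE 'X^(w i0) 1 0.
by rewrite -/T TE hornerZ !hornerXn hornerC !expr0n !eqn0Ngt h_gt0 w_gt0 mulr0.
Qed.

(** Scale a nonzero zero of W: it remains a zero, and its squared norm grows continuously from 0
    beyond delta^2. *)
Lemma link_nonempty (delta : R) : (0 < m)%N -> 0 < delta ->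
  exists p, link W delta p.
Proof.
move=> m0 delta0; have [z z0 Wz] := nonzero_zero m0.
pose s i : R := complex.Re (z i 0) ^+ 2 + complex.Im (z i 0) ^+ 2.
have sE i : (s i)%:C = `|z i 0| ^+ 2 by rewrite add_Re2_Im2.
have s_ge0 i : 0 <= s i by rewrite addr_ge0 ?sqr_ge0.
pose g (x : R) := \sum_i (x ^+ w i) ^+ 2 * s i.
have [i si] : exists i, s i != 0.
  have : ~~ [forall i, z i 0 == 0].
    apply: contra z0 => /forallP z0; apply/eqP/colP => i.
    by rewrite mxE; apply/eqP.
  rewrite negb_forall => /existsP[i zi]; exists i.
  apply/eqP => si0; have := sE i; rewrite si0 => /esym/eqP.
  by rewrite sqrf_eq0 normr_eq0 (negPf zi).
have si_gt0 : 0 < s i by rewrite lt_def si s_ge0.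
(* As b >= 1, b^(2 w_i) >= b >= delta^2 / s_i, so coordinate i alone reaches delta^2. *)
pose b := 1 + delta ^+ 2 / s i.
have b1 : 1 <= b by rewrite lerDl divr_ge0 ?sqr_ge0.
have g0 : g 0 = 0.
  rewrite /g big1 // => j _.
  by rewrite expr0n eqn0Ngt w_gt0 expr0n mul0r.
have gb : delta ^+ 2 <= g b.
  apply: (@le_trans _ _ ((b ^+ w i) ^+ 2 * s i)); last first.
    rewrite /g (bigD1 i) //= lerDl sumr_ge0 // => j _.
    by rewrite mulr_ge0 // sqr_ge0.
  rewrite -ler_pdivrMr // -exprM; apply: (@le_trans _ _ b).
    by rewrite lerDr.
  by rewrite ler_eXnr // muln_gt0 w_gt0.
have gc : continuous g.
  move=> x; apply: cvg_big => [|j _]; first exact: (@add_continuous R).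
  apply: cvgM; last exact: cvg_cst.
  under eq_cvg do rewrite -exprM; rewrite -exprM; exact: exprn_continuous.
have [|||x /andP[x0 xb] gx] := @IVT R g 0 b (delta ^+ 2).
- by rewrite (le_trans ler01).
- exact: continuous_subspaceT.
- rewrite g0 min_l ?max_r ?gb ?sqr_ge0 //; apply: le_trans gb; exact: sqr_ge0.
exists (diag_mx (weight_scaling w x%:C) *m z); split.
  by rewrite (homogeneity W_homogeneous) Wz mulr0.
rewrite -gx /g rmorph_sum; apply: eq_bigr => j _.
rewrite mul_diag_mxE mxE normrM exprMn [RHS]rmorphM -sE; congr (_ * _).
have -> : x%:C ^+ w j = (x ^+ w j)%:C :> C by rewrite rmorphXn.
by rewrite -add_Re2_Im2 /= expr0n addr0.
Qed.

End Links.

(** * The dimension of the space of principal orbits *)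

Section PrincipalDimension.
Variables (R : realType) (m : nat) (W : mpoly.mpoly m.+1 R[i]).
Variables (w : 'I_m.+1 -> nat) (h : nat).
Hypothesis W_homogeneous : weighted_homogeneous W w h.
Local Notation C := R[i].
Local Notation Jinv := (map_mx GRing.inv (monodromy R w h) : 'rV[C]_m.+1).
Implicit Types (p v : 'cV[C]_m.+1).

Lemma principal_Sigma delta p :
  Sigma W w h delta Jinv 1 p <-> link W delta p.
Proof. split=> [[//]|Lp]; split=> //; exact: principal_twist. Qed.

(** The complex equation dW = 0 counts as two real ones, the real parts of dW and of i dW; the third
    form is that of the sphere. *)
Definition tangent_forms p (j : 'I_3) : 'rV[C]_m.+1 :=
  tnth [tuple \row_i pderiv W i p; 'i%C *: \row_i pderiv W i p; p^t*] j.

Lemma principal_tangentP p v :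
  tangent_Sigma W w h Jinv 1 p v <->
  forall j, complex.Re ((tangent_forms p j *m v) 0 0) = 0.
Proof.
split=> [[dv pv _]|H].
  case=> [] [|[|[|//]]] jlt; rewrite /tangent_forms (tnth_nth 0) /= //.
    by rewrite -dpeval_row dv.
  by rewrite -scalemxAl mxE -dpeval_row dv mulr0.
have := H 0; have := H 1; have := H 2%:R.
rewrite /tangent_forms !(tnth_nth 0) /= => pv.
rewrite -scalemxAl mxE -!dpeval_row mulrC ReiNIm => /eqP.
rewrite oppr_eq0 => /eqP Imv Rev; split=> //; last exact: principal_twist.
by rewrite [LHS]complexE Rev Imv mulr0 addr0.
Qed.

(* The Euler field (w_i p_i) lies in the kernel of dW but is not tangent to the
   sphere. *)
Lemma tangent_forms_free p (c : 'I_3 -> R) :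
  p != 0 -> peval W p = 0 -> grad_sqnorm W p != 0 ->
  \sum_j (c j)%:C *: tangent_forms p j = 0 -> forall j, c j = 0.
Proof.
move=> p0 Wp N0.
rewrite !big_ord_recl big_ord0 addr0 /tangent_forms !(tnth_nth 0) /=.
set a := \row_i pderiv W i p; set c0 := c _; set c1 := c _; set c2 := c _ => E.
have a_neq0 : a != 0.
  apply: contra N0 => /eqP/rowP a0; rewrite grad_sqnorm_eq0.
  by apply/forallP => i; have := a0 i; rewrite !mxE => ->.
pose e : 'cV[C]_m.+1 := \col_i ((w i)%:R * p i 0).
have ae : a *m e = 0.
  apply/matrixP => i j; rewrite !ord1 -dpeval_row.
  by rewrite (euler_identity W_homogeneous) Wp mulr0 mxE.
have pe : (p^t* *m e) 0 0 != 0.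
  rewrite mxE (eq_bigr (fun i => (w i)%:R * `|p i 0| ^+ 2)) => [|i _].
    rewrite psumr_neq0 => [|i _]; last by rewrite mulr_ge0 // exprn_ge0.
    have : ~~ [forall i, p i 0 == 0].
      apply: contra p0 => /forallP p0; apply/eqP/colP => i.
      by rewrite mxE; apply/eqP.
    rewrite negb_forall => /existsP[i pi]; apply/hasP; exists i => //=.
      by rewrite mem_index_enum.
    rewrite mulr_gt0 ?ltr0n ?(weight_gt0 W_homogeneous) //.
    by rewrite exprn_gt0 // normr_gt0.
  by rewrite !mxE normCKC mulrCA.
(* Evaluating the relation on the Euler field kills the two terms in dW. *)
have c20 : c2 = 0.
  have := congr1 (fun M => M *m e) E.
  rewrite /= !mulmxDl -!scalemxAl ae !scaler0 !add0r mul0mx => /eqP.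
  rewrite scaler_eq0 => /orP[/eqP[] //|/eqP pe0].
  by rewrite pe0 mxE eqxx in pe.
move: E; rewrite c20 scale0r addr0 scalerA -scalerDl => /eqP.
rewrite scaler_eq0 (negPf a_neq0) orbF => /eqP E.
(* What remains is c0 + i c1 = 0 with real c0 and c1. *)
have [c00 c10] : c0 = 0 /\ c1 = 0.
  by move: E => [] /=;
    rewrite !(mul0r, mulr0, mulr1, addr0, add0r, subr0, oppr0).
case=> [] [|[|[|//]]] jlt.
- by rewrite -c00; congr c; apply: val_inj.
- by rewrite -c10; congr c; apply: val_inj.
- by rewrite -c20; congr c; apply: val_inj.
Qed.

Lemma link_neq0 delta p : 0 < delta -> link W delta p -> p != 0.
Proof.
move=> delta0 [_ pE]; apply/eqP => p0; move: pE.
rewrite p0 big1 => [|i _]; last by rewrite mxE normr0 expr0n.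
by case=> /esym/eqP; rewrite sqrf_eq0 gt_eqF.
Qed.

(** Three independent real equations in real dimension 2 (m + 1), at every point of the link. A
    point and a basis exist, so [xget] does not return its default. *)
Lemma principal_dim_Sigma delta :
  (0 < m)%N -> 0 < delta -> isolated_singularity0 W ->
  (dim_Sigma W w h delta Jinv 1 + 3 = m.+1 + m.+1)%N.
Proof.
move=> m0 delta0 isol; rewrite /dim_Sigma.
case: xgetP => [d _ [p [b [/principal_Sigma Lp bV]]]|none].
  apply: (real_basis_dim (principal_tangentP p) _ bV).
  have p0 := link_neq0 delta0 Lp.
  move=> c; apply: tangent_forms_free => //; first exact: Lp.1.
  by apply: (isolated_gradient_neq0 W_homogeneous); last exact: Lp.1.
have [p Lp] := link_nonempty W_homogeneous m0 delta0.
have [d [b bV]] := real_basis_exists (principal_tangentP p).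
by case: (none d); exists p, b; split=> //; exact/principal_Sigma.
Qed.

End PrincipalDimension.

(** * The degree and the index of the monodromy orbit *)

Theorem corollary9p6 (R : realType) (m : nat)
    (W : mpoly.mpoly m.+1 R[i]) (w : 'I_m.+1 -> nat) (h : nat) (delta : R)
    (m_gt0 : (0 < m)%N) (delta_gt0 : 0 < delta)
    (W_homogeneous : weighted_homogeneous W w h)
    (W_nondegenerate : nondegenerate_polynomial W) :
  gen_degree w h delta (monodromy_orbit W_homogeneous) =
    - mu_RS w h delta (monodromy_orbit W_homogeneous) /\
  - mu_RS w h delta (monodromy_orbit W_homogeneous) =
    - (2 * (\sum_i (w i)%:R - h%:R) / h%:R).
Proof.
have isol := W_nondegenerate.1.
have dim := principal_dim_Sigma W_homogeneous m_gt0 delta_gt0 isol.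
have h0 : h%:R != 0 :> R by rewrite pnatr_eq0 -lt0n (degree_gt0 W_homogeneous).
split.
  (* The class has degree 0 and the dimension is 2 m - 1, so m - (dim + 1) / 2 = 0 and only -mu is
     left. *)
  rewrite /gen_degree /star /=; move: (mu_RS _ _ _ _) => mu.
  have : (dim_Sigma W w h delta (map_mx GRing.inv (monodromy R w h)) 1)%:R + 3 =
    m.+1%:R + m.+1%:R :> R by rewrite -!natrD dim.
  by rewrite -natr1; lra.
congr (- _); rewrite -mulrA mulrBl mulr_suml mulfV //.
(* Every index in the set has the stated value, and a point of the link with its flow-invariant
   frame rules out the default of [xget]. *)
rewrite /mu_RS; case: xgetP => [mu _ [p _ /=]|none].
  by move=> /(principal_orbit_RS_index W_homogeneous).
have [p Lp] := link_nonempty W_homogeneous m_gt0 delta_gt0.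
case: (none (2 * (\sum_i (w i)%:R / h%:R - 1))); exists p.
  exact/principal_Sigma.
apply: (principal_orbit_RS_index_exists W_homogeneous).
apply: (isolated_gradient_neq0 W_homogeneous) => //; last exact: Lp.1.
exact: link_neq0 Lp.
Qed.
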